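(* Let $d \geq 2$ and let $B \subset Mat_d^0(\mathbb{Z})$ be a Bohr-zero non-periodic set. Then for every matrix $C \in Mat_d^0(\mathbb{Z})$ there exist a matrix $A \in B$ and a matrix $g \in SL_d(\mathbb{Z})$ such that $C = g^{-1}Ag$.
   Context: $Mat_d^0(\mathbb{Z})$ denotes the additive group of $d\times d$ integer matrices with trace zero, and $SL_d(\mathbb{Z})$ the group of $d\times d$ integer matrices of determinant one. $\mathbb{T}^n=\mathbb{R}^n/\mathbb{Z}^n$. For a countable abelian group $G$, a set $B\subset G$ is a non-periodic Bohr set if there exist $n\ge 1$, a homomorphism $\tau:G\to\mathbb{T}^n$ with $\overline{\tau(G)}=\mathbb{T}^n$, and an open set $U\subset\mathbb{T}^n$ with $B=\tau^{-1}(U)$; it is Bohr-zero if moreover $U$ contains the zero element of $\mathbb{T}^n$. *)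

(* Defs.v *)
From HB Require Import structures.
From mathcomp Require Import all_boot all_order all_algebra.
From mathcomp Require Import all_classical all_reals all_analysis.
From mathcomp Require Import Rstruct Rstruct_topology.
Set Implicit Arguments. Unset Strict Implicit. Unset Printing Implicit Defensive.
Import Order.TTheory GRing.Theory Num.Theory.
Local Open Scope ring_scope.
Local Open Scope classical_set_scope.

Definition tracefree (d : nat) (A : 'M[int]_d) : Prop := \tr A = 0.

Definition SLZ (d : nat) (g : 'M[int]_d) : Prop := \det g = 1.

Definition intvec (n : nat) (v : 'rV[Rdefinitions.R]_n) : Prop :=
  exists k : 'rV[int]_n, v = map_mx (fun z : int => z%:~R) k.

(* A homomorphism tau : Mat_d^0(Z) -> T^n = R^n/Z^n, represented by a lift
   tau : 'M[int]_d -> R^n (only its values on trace-zero matrices matter). *)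
Definition torus_hom (d n : nat) (tau : 'M[int]_d -> 'rV[Rdefinitions.R]_n) : Prop :=
  forall A B, tracefree A -> tracefree B ->
    intvec (tau (A + B) - tau A - tau B).

(* tau(G) is dense in T^n: its preimage tau(G) + Z^n is dense in R^n. *)
Definition torus_dense (d n : nat) (tau : 'M[int]_d -> 'rV[Rdefinitions.R]_n) : Prop :=
  closure [set v | exists A k, tracefree A /\ intvec k /\ v = tau A + k] = setT.

(* Open subsets of T^n, represented by their (Z^n-invariant, open) preimages in R^n. *)
Definition torus_open (n : nat) (U : set 'rV[Rdefinitions.R]_n) : Prop :=
  open U /\ forall x k, intvec k -> U x -> U (x + k).

Definition bohr_zero_nonperiodic (d : nat) (B : set 'M[int]_d) : Prop :=
  exists (n : nat) (tau : 'M[int]_d -> 'rV[Rdefinitions.R]_n) (U : set 'rV[Rdefinitions.R]_n),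
    [/\ (0 < n)%N, torus_hom tau, torus_dense tau, torus_open U
      & U 0 /\ B = [set A | tracefree A /\ U (tau A)]].

(* Main.v *)
From HB Require Import structures.
Require Import Defs.
From mathcomp Require Import all_boot all_order all_algebra.
From mathcomp Require Import all_classical all_reals all_analysis.
From mathcomp Require Import Rstruct Rstruct_topology.
From mathcomp Require Import complex ring lra zify trigo.
Import Order.TTheory GRing.Theory Num.Theory numFieldNormedType.Exports.
Set Implicit Arguments. Unset Strict Implicit. Unset Printing Implicit Defensive.
Local Open Scope ring_scope.

(** If [N = u v^T] with [v^T u = 0], conjugating [C] by [1 + 2 m N] gives
    [C + 2 m (N C - C N) - 4 m^2 tr(C N) N], a quadratic polynomial in [m] whose
    leading term is a multiple of [N].  Fix a neighbourhood of [0] in the torus: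
    only finitely many characters of the torus matter for hitting it.  Density of
    [tau] makes each nontrivial character composed with [tau] of infinite image, so
    the matrices on which it takes torsion values form a proper pure subgroup of
    the trace-zero matrices; so does the kernel of [A |-> tr(C A)] when [C <> 0].
    Matrices of the form of [N] span the trace-zero matrices, and can be chosen
    outside finitely many proper pure subgroups.  For such an [N] the relevant
    characters have mean zero along the quadratic sequence (van der Corput), and a
    Fejér kernel argument shows that the sequence visits the neighbourhood. *)

(** * Pure subgroups and rank-one nilpotent matrices *)

(** Purity permits division by positive integers, so divided differences of a polynomial sequence
    stay in the subgroup. *)
Definition pure_subgroup (V : zmodType) (Z : V -> Prop) :=
  [/\ Z 0, forall x y, Z x -> Z y -> Z (x - y)
    & forall x n, (0 < n)%N -> Z (x *+ n) -> Z x].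

Lemma pureD (V : zmodType) (Z : V -> Prop) x y :
  pure_subgroup Z -> Z x -> Z y -> Z (x + y).
Proof. by move=> [Z0 ZB _] Zx Zy; rewrite -[y]opprK -[- y]sub0r; apply/ZB/ZB. Qed.

Lemma pureMn (V : zmodType) (Z : V -> Prop) x n :
  pure_subgroup Z -> Z x -> Z (x *+ n).
Proof.
move=> Zp Zx; elim: n => [|n IHn]; first by case: Zp.
by rewrite mulrS; apply: pureD.
Qed.

Lemma pureBl (V : zmodType) (Z : V -> Prop) x y :
  pure_subgroup Z -> Z (x + y) -> Z y -> Z x.
Proof. by move=> [_ ZB _] Zxy Zy; rewrite -[x](addrK y); apply: ZB. Qed.

Definition unboundedly (P : nat -> Prop) := forall T, exists2 t, (T <= t)%N & P t.

Lemma pure_affine (d : nat) (Z : 'M[int]_d -> Prop) a b : pure_subgroup Z ->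
  unboundedly (fun t => Z (a + b *+ t)) -> Z a /\ Z b.
Proof.
move=> Zp U; have [Z0 ZB ZM] := Zp.
have [s _ Zs] := U 0%N; have [t st Zt] := U s.+1.
have Zb : Z b.
  apply: (ZM _ (t - s)%N); first by rewrite subn_gt0.
  suff -> : b *+ (t - s) = (a + b *+ t) - (a + b *+ s) by exact: ZB.
  by rewrite -(subnK (ltnW st)) addnK; apply/matrixP => i j; rewrite !mxE !mulmxnE; ring.
by split=> //; apply: pureBl Zs _ => //; apply: pureMn.
Qed.

(* Divided differences at [s] lower the degree by one. *)
Lemma pure_quadratic (d : nat) (Z : 'M[int]_d -> Prop) a b c : pure_subgroup Z ->
  unboundedly (fun t => Z (a + b *+ t + c *+ t ^ 2)) -> [/\ Z a, Z b & Z c].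
Proof.
move=> Zp U; have [Z0 ZB ZM] := Zp; have [s _ Zs] := U 0%N.
have [||Zbc Zc] := @pure_affine d Z (b + c *+ s) c => //.
  move=> T; have [t tT Zt] := U (maxn T s.+1); exists t; first by lia.
  apply: (ZM _ (t - s)%N); first by lia.
  suff -> : (b + c *+ s + c *+ t) *+ (t - s)
     = (a + b *+ t + c *+ t ^ 2) - (a + b *+ s + c *+ s ^ 2) by exact: ZB.
  have [k ->] : exists k, t = (s + k)%N by exists (t - s)%N; lia.
  by rewrite addKn; apply/matrixP => i j; rewrite !(mxE, mulmxnE); ring.
have Zb : Z b by apply: pureBl Zbc _ => //; apply: pureMn.
by split=> //; apply: pureBl (pureBl Zp Zs _) _ => //; apply: pureMn.
Qed.

Lemma pure_cubic (d : nat) (Z : 'M[int]_d -> Prop) a b c e : pure_subgroup Z ->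
  unboundedly (fun t => Z (a + b *+ t + c *+ t ^ 2 + e *+ t ^ 3)) -> Z a /\ Z e.
Proof.
move=> Zp U; have [Z0 ZB ZM] := Zp; have [s _ Zs] := U 0%N.
have [||Zbce Zce Ze] :=
    @pure_quadratic d Z (b + c *+ s + e *+ s ^ 2) (c + e *+ s) e => //.
  move=> T; have [t tT Zt] := U (maxn T s.+1); exists t; first by lia.
  apply: (ZM _ (t - s)%N); first by lia.
  suff -> : (b + c *+ s + e *+ s ^ 2 + (c + e *+ s) *+ t + e *+ t ^ 2) *+ (t - s)
     = (a + b *+ t + c *+ t ^ 2 + e *+ t ^ 3)
       - (a + b *+ s + c *+ s ^ 2 + e *+ s ^ 3) by exact: ZB.
  have [k ->] : exists k, t = (s + k)%N by exists (t - s)%N; lia.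
  by rewrite addKn; apply/matrixP => i j; rewrite !(mxE, mulmxnE); ring.
have Zc : Z c by apply: pureBl Zce _ => //; apply: pureMn.
have Zb : Z b.
  by apply: pureBl (pureBl Zp Zbce _) _ => //; apply: pureMn.
split=> //; apply: pureBl (pureBl Zp (pureBl Zp Zs _) _) _ => //; exact: pureMn.
Qed.

(* With [J = p.2 - p.2^T] skew, [u^T J u = 0] for free; so these rank-one
   nilpotent matrices are parametrised by a free module, and any two of them lie
   on the image of a line of parameters, along which the entries are cubic. *)
Definition skew_nilpotent (d : nat) (p : 'cV[int]_d * 'M[int]_d) : 'M[int]_d :=
  p.1 *m (p.1^T *m (p.2 - p.2^T)).

Lemma skew_nilpotent_row_col (d : nat) (p : 'cV[int]_d * 'M[int]_d) :
  (p.1^T *m (p.2 - p.2^T)) *m p.1 = 0.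
Proof.
case: p => u J /=; rewrite mulmxBr mulmxBl; apply/eqP; rewrite subr_eq0; apply/eqP.
have tr1 (M : 'M[int]_1) : M^T = M by apply/matrixP => i j; rewrite mxE !ord1.
by rewrite -[LHS]tr1 !trmx_mul trmxK mulmxA.
Qed.

Lemma skew_nilpotent_tracefree (d : nat) (p : 'cV[int]_d * 'M[int]_d) :
  tracefree (skew_nilpotent p).
Proof. by rewrite /tracefree mxtrace_mulC skew_nilpotent_row_col linear0. Qed.

(** In [(u v) A (u v)] the middle factor [v A u] is a 1 by 1 matrix, hence a scalar equal to the
    trace of [A u v]. *)
Lemma skew_nilpotent_sandwich (d : nat) (p : 'cV[int]_d * 'M[int]_d) (A : 'M[int]_d) :
  skew_nilpotent p *m A *m skew_nilpotent p
  = \tr (A *m skew_nilpotent p) *: skew_nilpotent p.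
Proof.
rewrite /skew_nilpotent; set v := _ *m (_ - _); set u := p.1.
rewrite -2!mulmxA (mulmxA A) (mulmxA v) [v *m _]mx11_scalar mul_scalar_mx -scalemxAr.
by rewrite [X in _ = X *: _]mxtrace_mulC [in RHS]/mxtrace big_ord1.
Qed.

Lemma skew_nilpotent_sqr (d : nat) (p : 'cV[int]_d * 'M[int]_d) :
  skew_nilpotent p *m skew_nilpotent p = 0.
Proof.
by rewrite /skew_nilpotent -mulmxA (mulmxA _ p.1) skew_nilpotent_row_col mul0mx mulmx0.
Qed.

Lemma skew_nilpotent_line (d : nat) (p q : 'cV[int]_d * 'M[int]_d) :
  exists b c, forall t, skew_nilpotent (p + q *+ t)
    = skew_nilpotent p + b *+ t + c *+ t ^ 2 + skew_nilpotent q *+ t ^ 3.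
Proof.
have qt t : q *+ t = (q.1 *+ t, q.2 *+ t).
  by elim: t => [|t IH]; rewrite ?mulr0n// !mulrS IH.
case: p q qt => [u J] [u' J'] qt; pose S := J - J^T; pose S' := J' - J'^T.
exists (u *m (u^T *m S') + (u *m (u'^T *m S)) + u' *m (u^T *m S)).
exists (u' *m (u'^T *m S) + (u' *m (u^T *m S')) + u *m (u'^T *m S')) => t.
rewrite /skew_nilpotent qt /=.
have -> : J + J' *+ t - (J + J' *+ t)^T = S + S' *+ t.
  by apply/matrixP => i j; rewrite !(mxE, mulmxnE); ring.
rewrite -/S -/S'; clearbody S S'.
have -> : (u + u' *+ t)^T = u^T + t%:R *: u'^T.
  by rewrite -scaler_nat; apply/matrixP => i j; rewrite !mxE.
rewrite -!scaler_nat !natrX !(mulmxDl, mulmxDr) -!(scalemxAl, scalemxAr).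
rewrite !scalerDr !scalerA.
repeat match goal with |- context [?x *m (?y *m ?z)] =>
  move: (x *m (y *m z)) => ? end.
by apply/matrixP => i j; rewrite !mxE; ring.
Qed.

Lemma tracefree_ind (d : nat) (P : 'M[int]_d.+1 -> Prop) :
  P 0 -> (forall A B, P A -> P B -> P (A - B)) ->
  (forall i j, i != j -> P (delta_mx i j)) ->
  (forall i, P (delta_mx i i - delta_mx ord0 ord0)) ->
  forall A, tracefree A -> P A.
Proof.
move=> P0 PB Poff Pdiag A A0.
have PD X Y : P X -> P Y -> P (X + Y).
  by move=> PX PY; rewrite -[Y]opprK -[- Y]sub0r; apply/PB/PB.
have PZ (z : int) X : P X -> P (z *: X).
  move=> PX; have Pn n : P (n%:Z *: X).
    by elim: n => [|n IH]; rewrite ?scale0r// intS scalerDl scale1r; apply: PD.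
  by case: z => // n; rewrite NegzE scaleNr -sub0r; apply: PB.
have -> : A = \sum_i \sum_j A i j *:
    (if i == j then delta_mx i i - delta_mx ord0 ord0 else delta_mx i j).
  rewrite [LHS]matrix_sum_delta.
  (* The diagonal corrections add up to [\tr A] times [delta_mx ord0 ord0], which is zero. *)
  transitivity (\sum_i (\sum_j A i j *: delta_mx i j - A i i *: delta_mx ord0 ord0)).
    by rewrite sumrB -scaler_suml [X in X *: _]A0 scale0r subr0.
  apply: eq_bigr => i _; rewrite (bigD1 i)//= [RHS](bigD1 i)//= eqxx scalerBr addrAC.
  by congr (_ + _); apply: eq_bigr => j /negPf; rewrite eq_sym => ->.
elim/big_ind: _ => // i _; elim/big_ind: _ => // j _; apply: PZ.
by have [_|/Poff] := eqVneq i j.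
Qed.

Lemma tracefree_skew_nilpotent_ind (d : nat) (P : 'M[int]_d.+1 -> Prop) :
  P 0 -> (forall A B, P A -> P B -> P (A - B)) ->
  (forall p, P (skew_nilpotent p)) -> forall A, tracefree A -> P A.
Proof.
move=> P0 PB Pnil.
pose e i : 'cV[int]_d.+1 := delta_mx i 0.
have Poff i j : i != j -> P (delta_mx i j).
  move=> ij; have := Pnil (e i, delta_mx i j).
  rewrite /skew_nilpotent /= !trmx_delta mulmxBr !mul_delta_mx.
  by rewrite mul_delta_mx_0// subr0 mul_delta_mx.
apply: tracefree_ind => // i.
have [->|i0] := eqVneq i ord0; first by rewrite subrr.
have i0' : ord0 != i by rewrite eq_sym.
(* For [u = e_i + e_0] and [J = E_i0] the nilpotent matrix is [E_i0 - E_0i - (E_ii - E_00)]. *)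
have -> : delta_mx i i - delta_mx ord0 ord0 = delta_mx i ord0 - delta_mx ord0 i
    - skew_nilpotent (e i + e ord0, delta_mx i ord0).
  rewrite /skew_nilpotent /= [(_ + _)^T]linearD /= !trmx_delta !mulmxBr !(mulmxDl, mulmxDr).
  rewrite !mul_delta_mx !mul_delta_mx_0 // !mulmx0.
  by apply/matrixP => k l; rewrite !mxE; ring.
by apply: (PB) => //; apply: (PB); apply: Poff.
Qed.

(* On the line through a parameter good for the earlier [Z j] and one good for
   [Z i], a pure subgroup containing unboundedly many values of the cubic contains
   both its extreme coefficients; so far along the line all [Z j] are avoided. *)
Lemma skew_nilpotent_avoid (d : nat) (I : finType)
    (Z : I -> 'M[int]_d.+1 -> Prop) :
  (forall i, pure_subgroup (Z i)) ->
  (forall i, exists2 A, tracefree A & ~ Z i A) ->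
  exists p, forall i, ~ Z i (skew_nilpotent p).
Proof.
move=> Zpure Zproper.
suff [p pP] : exists p, forall i, i \in enum I -> ~ Z i (skew_nilpotent p).
  by exists p => i; apply: pP; rewrite mem_enum.
elim: (enum I) => [|i r [p pP]]; first by exists 0.
have [q Zq] : exists q, ~ Z i (skew_nilpotent q).
  apply/existsNP => Zall; have [A A0 []] := Zproper i.
  by have [Z0 ZB _] := Zpure i; apply: tracefree_skew_nilpotent_ind A0.
have [b [c bc]] := skew_nilpotent_line p q.
have good j : ~ Z j (skew_nilpotent p) \/ ~ Z j (skew_nilpotent q) ->
    exists T, forall t, (T <= t)%N -> ~ Z j (skew_nilpotent (p + q *+ t)).
  move=> pq; apply: contrapT => /forallNP bad.
  suff [Zp0 Zq0] : Z j (skew_nilpotent p) /\ Z j (skew_nilpotent q) by case: pq.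
  apply: (pure_cubic (b := b) (c := c) (Zpure j)) => T.
  have /existsNP[t /not_implyP[tT /contrapT Zt]] := bad T.
  by exists t => //; rewrite -bc.
have [T TP] : exists T, forall t, (T <= t)%N -> forall j, j \in r ->
    ~ Z j (skew_nilpotent (p + q *+ t)).
  elim: r pP {Zq} => [|j r IHr] pP; first by exists 0%N.
  have [|T1 T1P] := IHr; first by move=> k kr; apply: pP; rewrite inE kr orbT.
  have [|T2 T2P] := good j; first by left; apply: pP; rewrite mem_head.
  exists (maxn T1 T2) => t; rewrite geq_max => /andP[t1 t2] k.
  by rewrite inE => /predU1P[->|kr]; [apply: T2P | apply: T1P].
have [|T' T'P] := good i; first by right.
exists (p + q *+ maxn T T') => j; rewrite inE => /predU1P[->|jr].
  by apply: T'P; rewrite leq_maxr.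
by apply: TP => //; rewrite leq_maxl.
Qed.

Lemma pureZ (d : nat) (Z : 'M[int]_d -> Prop) (k : int) A :
  pure_subgroup Z -> k != 0 -> Z (k *: A) -> Z A.
Proof.
move=> Zp k0; have [Z0 ZB ZM] := Zp; have ZN X : Z (- X) -> Z X.
  by move=> ZX; rewrite -[X]opprK -sub0r; apply: ZB.
case: k k0 => n n0; rewrite ?NegzE ?scaleNr.
  by rewrite -[Posz n]natz scaler_nat; apply: ZM; rewrite lt0n.
by rewrite -[Posz _]natz scaler_nat => /ZN; apply: ZM.
Qed.

Lemma pure_trace_kernel (d : nat) (C : 'M[int]_d) :
  pure_subgroup (fun A => \tr (C *m A) = 0).
Proof.
split=> [|A B A0 B0|A n n0]; first by rewrite mulmx0 linear0.
  by rewrite mulmxBr linearB /= A0 B0 subrr.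
by rewrite -scaler_nat -scalemxAr linearZ /= => /eqP;
rewrite mulf_eq0 pnatr_eq0 -leqn0 leqNgt n0 => /eqP.
Qed.

(** Nondegeneracy of the trace form: pairing with [E_ij] kills the off-diagonal entries of [C],
    pairing with [E_ii - E_00] makes its diagonal constant, and trace zero makes that constant
    vanish. *)
Lemma trace_kernel_proper (d : nat) (C : 'M[int]_d.+1) : tracefree C -> C <> 0 ->
  exists2 A, tracefree A & \tr (C *m A) <> 0.
Proof.
move=> C0 nC0; apply: contrapT => H; apply: nC0.
have trC0 A : tracefree A -> \tr (C *m A) = 0.
  by move=> A0; apply: contrapT => CA; apply: H; exists A.
have tr_delta (i j : 'I_d.+1) : \tr (C *m delta_mx i j) = C j i.
  rewrite /mxtrace (bigD1 j)//= big1 ?addr0 => [|k kj]; rewrite !mxE (bigD1 i)//=.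
    by rewrite big1 ?addr0 => [|l li]; rewrite !mxE ?eqxx ?mulr1// (negPf li) mulr0.
  rewrite big1 ?addr0 => [|l li]; rewrite !mxE ?(negPf li) ?mulr0//.
  by rewrite (negPf kj) andbF mulr0.
have offC i j : i != j -> C i j = 0.
  move=> ij; rewrite -tr_delta trC0// /tracefree /mxtrace big1// => k _.
  by rewrite mxE; apply/eqP; rewrite pnatr_eq0 eqb0; apply: contraNN ij => /andP[/eqP <- /eqP <-].
have diagC i : C i i = C ord0 ord0.
  apply/eqP; rewrite -subr_eq0 -!tr_delta -linearB /= -mulmxBr trC0//.
  by rewrite /tracefree linearB /= -[delta_mx i i]mul1mx -[delta_mx ord0 ord0]mul1mx
    !(_ : forall i, \tr (1%:M *m delta_mx i i : 'M[int]_d.+1) = 1) ?subrr// => k;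
  rewrite mul1mx /mxtrace (bigD1 k)//= mxE !eqxx big1 ?addr0// => l lk; rewrite mxE (negPf lk).
have C00 : C ord0 ord0 = 0.
  move: C0; rewrite /tracefree /mxtrace; under eq_bigr do rewrite diagC.
  by rewrite sumr_const card_ord => /eqP; rewrite mulrn_eq0 => /eqP.
apply/matrixP => i j; rewrite mxE; have [->|/offC//] := eqVneq i j.
by rewrite diagC.
Qed.

(* [g = (1 + m N)^2]; taking a square makes the determinant [1] rather than [+-1]. *)
Lemma conj_skew_nilpotent (d : nat) (C : 'M[int]_d) p m : let N := skew_nilpotent p in
  exists g, [/\ SLZ g &
   C = invmx g
     *m (C + (2 *: (N *m C - C *m N)) *+ m + ((- 4 * \tr (C *m N)) *: N) *+ m ^ 2)
     *m g].
Proof.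
move=> N; have N2 : N *m N = 0 by apply: skew_nilpotent_sqr.
have NCN : N *m C *m N = \tr (C *m N) *: N by apply: skew_nilpotent_sandwich.
clearbody N; pose h (k : int) := 1%:M + k *: N.
have hM k l : h k *m h l = h (k + l).
  rewrite /h mulmxDl !mulmxDr mul1mx mulmx1 mul1mx -scalemxAl -scalemxAr N2 !scaler0 addr0.
  by rewrite scalerDl addrA addrAC.
have h0 : h 0 = 1%:M by rewrite /h scale0r addr0.
have hdet k : \det (h (k + k)) = 1.
  have : \det (h k) * \det (h (- k)) = 1 by rewrite -det_mulmx hM subrr h0 det1.
  move=> /(congr1 absz); rewrite abszM => /eqP; rewrite muln_eq1 => /andP[/eqP h1 _].
  by rewrite -hM det_mulmx -expr2 -real_normK ?num_real// -abszE h1.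
exists (h (m%:R + m%:R)); split; first exact: hdet.
have hu : h (m%:R + m%:R) \in unitmx by rewrite unitmxE hdet unitr1.
(* Multiplying by [g] on the left removes the inverse; what remains follows from [N N = 0] and
   [N C N = \tr (C N) N]. *)
apply: (can_inj (mulKmx hu)); rewrite !mulmxA mulmxV// mul1mx.
rewrite /h -!scaler_nat natrX !(mulmxDl, mulmxDr) !mulmx1 mul1mx.
rewrite -!scalemxAl -!scalemxAr !mulmxBl NCN -(mulmxA C N N) !N2 mulmx0 !scaler0.
move: (N *m C) (C *m N) (\tr _) => NC CN c.
by apply/matrixP => i j; rewrite !mxE; ring.
Qed.

(** * Mean values and the van der Corput argument *)

(** Convergence of the averages of [f] to [c]: the tolerance is [1/j], and both denominators [j] and
    [N] are cleared. *)
Definition has_mean (C : numClosedFieldType) (f : nat -> C) (c : C) :=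
  forall j : nat, exists N0 : nat, forall N : nat, (N0 <= N)%N ->
    `|\sum_(m < N) f m - c *+ N| *+ j <= N%:R.

Lemma eq_has_mean (C : numClosedFieldType) (f g : nat -> C) c :
  f =1 g -> has_mean f c -> has_mean g c.
Proof. by move=> /funext ->. Qed.

Lemma has_mean_cst (C : numClosedFieldType) (c : C) : has_mean (fun=> c) c.
Proof.
move=> j; exists 0%N => N _; rewrite sumr_const card_ord subrr normr0 mul0rn.
exact: ler0n.
Qed.

Lemma has_meanD (C : numClosedFieldType) (f g : nat -> C) a b :
  has_mean f a -> has_mean g b -> has_mean (f \+ g) (a + b).
Proof.
move=> fa gb j; have [N1 N1P] := fa j.*2; have [N2 N2P] := gb j.*2.
exists (maxn N1 N2) => N; rewrite geq_max => /andP[/N1P {}N1P /N2P {}N2P].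
rewrite -(@ler_pMn2r _ 2) // -mulrnA muln2.
rewrite big_split /= mulrnDl opprD addrACA.
apply: (@le_trans _ _ ((`|\sum_(i < N) f i - a *+ N| + `|\sum_(i < N) g i - b *+ N|) *+ j.*2)).
  by rewrite lerMn2r ler_normD orbT.
by rewrite mulrnDl mulr2n lerD.
Qed.

Lemma has_meanN (C : numClosedFieldType) (f : nat -> C) a :
  has_mean f a -> has_mean (fun m => - f m) (- a).
Proof.
move=> fa j; have [N0 N0P] := fa j; exists N0 => N /N0P.
by rewrite sumrN mulNrn -opprD normrN.
Qed.

Lemma has_mean_sum (C : numClosedFieldType) (I : Type) (r : seq I) (P : pred I)
    (f : I -> nat -> C) (a : I -> C) :
  (forall i, P i -> has_mean (f i) (a i)) ->
  has_mean (fun m => \sum_(i <- r | P i) f i m) (\sum_(i <- r | P i) a i).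
Proof.
move=> fa; elim: r => [|i r IHr].
  by rewrite big_nil; apply: eq_has_mean (has_mean_cst 0) => m; rewrite big_nil.
rewrite big_cons; case: ifPn => Pi.
  apply: eq_has_mean (has_meanD (fa i Pi) IHr) => m /=.
  by rewrite big_cons Pi.
by apply: eq_has_mean IHr => m; rewrite big_cons (negPf Pi).
Qed.

Lemma has_meanMn (C : numClosedFieldType) (f : nat -> C) a n :
  has_mean f a -> has_mean (fun m => f m *+ n) (a *+ n).
Proof.
move=> fa.
have := @has_mean_sum C 'I_n (index_enum _) xpredT (fun=> f) (fun=> a) (fun _ _ => fa).
rewrite sumr_const card_ord; apply: eq_has_mean => m.
by rewrite sumr_const card_ord.
Qed.

(** The mean is an integer, so if negative it is at most [-1]; the nonnegative partial sums would
    then be at distance at least [N] from [N] times the mean, and tolerance [1/2] excludes this. *)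
Lemma has_mean_natr_ge0 (C : numClosedFieldType) (f : nat -> C) (a b : nat) :
  has_mean f (a%:R - b%:R) -> (forall m, 0 <= f m) -> (b <= a)%N.
Proof.
move=> fab f0; rewrite leqNgt; apply/negP => ab.
have [N0 /(_ N0.+1 (leqnSn _))] := fab 2.
set S := \sum_(_ < _) _; have S0 : 0 <= S by apply: sumr_ge0.
have -> : S - (a%:R - b%:R) *+ N0.+1 = S + ((b - a) * N0.+1)%:R.
  by rewrite natrM natrB 1?ltnW// mulr_natr -mulNrn opprB.
rewrite ger0_norm ?addr_ge0 ?ler0n// => le2.
have : (((b - a) * N0.+1) * 2)%:R <= N0.+1%:R :> C.
  apply: le_trans le2; rewrite natrM mulr_natr lerMn2r /=.
  by rewrite lerDr.
rewrite ler_nat leqNgt => /negP; apply.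
by rewrite mulnC mulnA ltn_Pmull//; lia.
Qed.

Lemma sum_geom_norm_le (C : numClosedFieldType) (w : C) N :
  `|w| = 1 -> `|\sum_(m < N) w ^+ m| * `|w - 1| <= 2.
Proof.
move=> w1; rewrite -normrM mulrC -subrX1.
by apply: le_trans (ler_normB _ _) _; rewrite normrX w1 expr1n normr1.
Qed.

(** Each unit shift exchanges one boundary term for another, both of norm at most 1. *)
Lemma sum_shift_norm_le (C : numClosedFieldType) (f : nat -> C) N h :
  (forall m, `|f m| <= 1) ->
  `|\sum_(m < N) f (m + h)%N - \sum_(m < N) f m| <= h.*2%:R.
Proof.
move=> f1; elim: h => [|h IHh].
  by under eq_bigr do rewrite addn0; rewrite subrr normr0.
have -> : \sum_(m < N) f (m + h.+1)%N
    = \sum_(m < N) f (m + h)%N + (f (N + h)%N - f h).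
  transitivity (\sum_(m < N.+1) f (m + h)%N - f h).
    by rewrite big_ord_recl /= add0n addrC addKr; apply: eq_bigr => i _; rewrite addSnnS.
  by rewrite big_ord_recr /= addrA.
rewrite addrAC; apply: le_trans (ler_normD _ _) _.
rewrite doubleS -addn2 natrD lerD//; apply: le_trans (ler_normB _ _) _.
by rewrite [2]mulr2n lerD.
Qed.

(* Van der Corput's difference argument, with [j ^ 2] shifts. *)
Lemma has_mean_van_der_corput (C : numClosedFieldType) (f : nat -> C) :
  (forall m, `|f m| <= 1) ->
  (forall h k, h <> k -> exists K : nat, forall N,
      `|\sum_(m < N) f (m + h)%N * (f (m + k)%N)^* | <= K%:R) ->
  has_mean f 0.
Proof.
move=> f1 fcor.
(* The factor 2 is absorbed by using this at [2 * (j + 1)], which is also positive. *)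
suff H j : (0 < j)%N -> exists N0 : nat, forall N : nat, (N0 <= N)%N ->
    `|\sum_(m < N) f m| *+ j <= N%:R *+ 2.
  move=> j; have [N0 N0P] := H j.*2.+2 isT; exists N0 => N /N0P.
  rewrite mul0rn subr0 -doubleS -muln2 mulrnA lerMn2r /=; apply: le_trans.
  by rewrite mulrSr lerDl.
move=> j0; pose H := (j ^ 2)%N.
have /choice[K KP] : forall p : 'I_H * 'I_H, exists k : nat, p.1 <> p.2 -> forall N,
    `|\sum_(m < N) f (m + p.1)%N * (f (m + p.2)%N)^* | <= k%:R.
  move=> [h k] /=.
  have [->|/eqP hk] := eqVneq h k; first by exists 0%N.
  have /fcor[k' k'P] : h <> k :> nat by move/val_inj.
  by exists k'.
pose K' := (\sum_p K p)%N.
(* The correlation bounds and the boundary terms of the shifts do not grow with [N]; past this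
   threshold they contribute at most [2 * N * H] to the final estimate. *)
exists (K' + H * H.*2 * j)%N => N NP.
pose g m := \sum_(h < H) f (m + h)%N.
have corr (p : 'I_H * 'I_H) :
    `|\sum_(m < N) f (m + p.1)%N * (f (m + p.2)%N)^* |
      <= (N * (p.1 == p.2))%:R + (K p)%:R.
  have [e|/eqP ne] := eqVneq; last by rewrite muln0 add0r; apply: KP.
  rewrite muln1 -natrD; apply: le_trans (ler_norm_sum _ _ _) _.
  apply: (@le_trans _ _ (\sum_(m < N) 1)); last first.
    by rewrite sumr_const card_ord ler_nat leq_addr.
  apply: ler_sum => m _; rewrite normrM norm_conjC.
  by rewrite -[leRHS]mulr1 ler_pM.
(* Expanding the square gives pairs of shifts: each of the [H] diagonal pairs contributes at most
   [N], the others a bounded amount. *)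
have g2 : \sum_(m < N) `|g m| ^+ 2 <= (N * H + K')%:R.
  rewrite -[leLHS]ger0_norm ?sumr_ge0//.
  have -> : \sum_(m < N) `|g m| ^+ 2 = \sum_(p : 'I_H * 'I_H)
      \sum_(m < N) f (m + p.1)%N * (f (m + p.2)%N)^*.
    rewrite exchange_big /=; apply: eq_bigr => m _.
    by rewrite normCK /g rmorph_sum big_distrlr /= pair_big.
  apply: le_trans (ler_norm_sum _ _ _) _.
  apply: le_trans (ler_sum _ (fun p _ => corr p)) _.
  rewrite big_split /= -natr_sum -natr_sum -natrD ler_nat leq_add2r.
  rewrite -big_distrr /= leq_mul2l -(pair_bigA _ (fun h k : 'I_H => (h == k) : nat)) /=.
  apply/orP; right; rewrite -[leqRHS]mul1n -[H in leqRHS]card_ord mulnC -sum_nat_const.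
  by apply: leq_sum => h _; rewrite (bigD1 h)//= eqxx big1 ?addn0// => k /negPf; rewrite eq_sym => ->.
have gS : `|\sum_(m < N) f m| *+ H <= \sum_(m < N) `|g m| + (H * H.*2)%:R.
  rewrite -normrMn.
  have -> : (\sum_(m < N) f m) *+ H = \sum_(m < N) g m
     - \sum_(h < H) (\sum_(m < N) f (m + h)%N - \sum_(m < N) f m).
    by rewrite sumrB sumr_const card_ord /g exchange_big /= opprB addrC subrK.
  apply: le_trans (ler_normB _ _) _; rewrite lerD// ?ler_norm_sum//.
  apply: le_trans (ler_norm_sum _ _ _) _.
  apply: (@le_trans _ _ (\sum_(h < H) H.*2%:R)).
    apply: ler_sum => h _; apply: le_trans (sum_shift_norm_le _ _ _) _ => //.
    by rewrite ler_nat leq_double ltnW.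
  by rewrite sumr_const card_ord natrM mulr_natl.
(* AM-GM: 2 j |g| <= j ^ 2 + |g| ^ 2 *)
have gj : (\sum_(m < N) `|g m|) *+ (2 * j) <= (N * H)%:R + (N * H + K')%:R.
  apply: (@le_trans _ _ (\sum_(m < N) (H%:R + `|g m| ^+ 2))); last first.
    by rewrite big_split /= sumr_const card_ord lerD// mulnC natrM mulr_natr.
  rewrite -sumrMnl; apply: ler_sum => m _.
  have : 0 <= (j%:R - `|g m|) ^+ 2.
    by rewrite real_exprn_even_ge0// rpredB// ?normr_real ?realn.
  rewrite sqrrB -natrX -/H => g0; rewrite -subr_ge0; apply: le_trans g0 _.
  by rewrite mulr_natl -mulrnA mulnC addrAC.
have : `|\sum_(m < N) f m| *+ j *+ (2 * H) <= N%:R *+ 2 *+ (2 * H).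
  apply: (@le_trans _ _ ((\sum_(m < N) `|g m| + (H * H.*2)%:R) *+ (2 * j))).
    by rewrite -mulrnA (_ : (j * (2 * H) = H * (2 * j))%N) 1?mulrnA ?lerMn2r ?gS ?orbT//; lia.
  apply: (@le_trans _ _ ((N * H)%:R + (N * H + K')%:R + (H * H.*2)%:R *+ (2 * j))).
    by rewrite mulrnDl lerD2r.
  rewrite -!mulrnA -!mulrnDr ler_nat.
  by have : (0 < H)%N; [rewrite expn_gt0 j0 | nia].
by rewrite lerMn2r; have : (0 < H)%N; [rewrite expn_gt0 j0 | case: (H)].
Qed.

Lemma unit_expr_inj (C : numClosedFieldType) (w : C) h k :
  `|w| = 1 -> (forall n, (0 < n)%N -> w ^+ n != 1) -> w ^+ h = w ^+ k -> h = k.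
Proof.
move=> w1 wn1; wlog hk : h k / (h <= k)%N.
  move=> H; have [/H//|/ltnW kh whk] := leqP h k.
  by apply/esym/H.
have [->//|/negPf nhk] := eqVneq h k; rewrite -(subnK hk) exprD -[LHS]mul1r.
have wk : w ^+ h != 0 by rewrite expf_neq0// -normr_eq0 w1 oner_eq0.
move=> /(mulIf wk)/esym/eqP; apply: contraTeq => _.
by rewrite wn1// subn_gt0 ltn_neqAle nhk.
Qed.

(** Correlating two shifts [h], [k] cancels the quadratic term and leaves a geometric sequence of
    ratio [w ^ (2 (h - k))]. This ratio is not 1, so its partial sums are bounded and van der Corput
    applies. *)
Lemma has_mean_quadratic_phase (C : numClosedFieldType) (v u w : C) :
  (forall x : C, exists n : nat, `|x| <= n%:R) ->
  `|v| = 1 -> `|u| = 1 -> `|w| = 1 -> (forall n, (0 < n)%N -> w ^+ n != 1) ->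
  has_mean (fun m => v * u ^+ m * w ^+ (m ^ 2)) 0.
Proof.
move=> archi v1 u1 w1 wn1.
have f1 m : `|v * u ^+ m * w ^+ (m ^ 2)| = 1.
  by rewrite !normrM !normrX v1 u1 w1 !expr1n !mulr1.
apply: has_mean_van_der_corput => [m|h k hk]; first by rewrite f1.
pose r := w ^+ (2 * h) * (w ^+ (2 * k))^*.
pose A := v * u ^+ h * w ^+ (h ^ 2) * (v * u ^+ k * w ^+ (k ^ 2))^*.
have unitP (z : C) n : `|z| = 1 -> z ^+ n * z^* ^+ n = 1.
  by move=> z1; rewrite -exprMn -normCK z1 !expr1n.
have corrE m : v * u ^+ (m + h) * w ^+ ((m + h) ^ 2)
    * (v * u ^+ (m + k) * w ^+ ((m + k) ^ 2))^* = A * r ^+ m.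
  rewrite /A /r !rmorphM !rmorphXn /= !sqrnD !exprD !exprMn -!exprM.
  rewrite !mul0n !expr0 !(mulnC m).
  apply: etrans (_ : (u ^+ m * u^* ^+ m) * (w ^+ (m ^ 2) * w^* ^+ (m ^ 2)) * _ = _).
    2: by rewrite !unitP// !mul1r.
  by ring.
have r1 : r - 1 != 0.
  rewrite subr_eq0; apply/eqP => r1; apply: hk.
  have /eqP : (2 * h)%N = (2 * k)%N.
    apply: (unit_expr_inj w1 wn1); rewrite -[RHS]mul1r -r1 /r -mulrA [_^* * _]mulrC.
    by rewrite rmorphXn unitP// mulr1.
  by rewrite eqn_mul2l => /eqP.
have [K KP] := archi (2 / (r - 1)); exists K => N.
under eq_bigr do rewrite corrE.
rewrite -mulr_sumr normrM; have -> : `|A| = 1 by rewrite normrM norm_conjC !f1 mulr1.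
rewrite mul1r; apply: le_trans KP; rewrite normrM normfV normr_nat ler_pdivlMr ?normr_gt0//.
apply: sum_geom_norm_le; rewrite /r normrM norm_conjC !normrX w1 !expr1n; exact: mulr1.
Qed.

(** * Fejér products and simultaneous approximation *)

Section TrigPolynomials.
Context (C : numClosedFieldType) (n M : nat) (z : 'I_n -> nat -> C).
Context (orth : forall f g : {ffun 'I_n -> 'I_M}, f != g ->
  has_mean (fun m => \prod_i z i m ^+ f i * (\prod_i z i m ^+ g i)^*) 0).
Context (unit_z : forall i m, `|z i m| = 1).

Let W (Q : 'I_n -> pred 'I_M) m := \prod_i \sum_(a | Q i a) z i m ^+ a.

(** Parseval: the square expands over pairs of exponent vectors allowed by [Q]; equal pairs give the
    constant 1, distinct ones have mean zero by [orth]. *)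
Lemma has_mean_norm_trig (Q : 'I_n -> pred 'I_M) :
  has_mean (fun m => `|W Q m| ^+ 2) (\prod_i #|Q i|)%:R.
Proof.
have -> : (\prod_i #|Q i|)%:R = \sum_(f in family Q) \sum_(g in family Q) (f == g)%:R :> C.
  have -> : (\prod_i #|Q i|)%N = #|family Q|.
    by rewrite card_family foldrE big_map big_enum.
  rewrite -sum1_card natr_sum; apply: eq_bigr => f fQ.
  by rewrite (bigD1 f)//= eqxx big1 ?addr0// => g /andP[_ /negPf]; rewrite eq_sym => ->.
apply: (@eq_has_mean _ (fun m => \sum_(f in family Q) \sum_(g in family Q)
   (\prod_i z i m ^+ f i * (\prod_i z i m ^+ g i)^*))).
  by move=> m; rewrite normCK /W bigA_distr_big_dep rmorph_sum big_distrlr.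
apply: has_mean_sum => f _; apply: has_mean_sum => g _.
have [<-|/orth//] := eqVneq f g; apply: eq_has_mean (has_mean_cst 1) => m.
by rewrite -normCK normr_prod big1 ?expr1n// => i _; rewrite normrX unit_z expr1n.
Qed.

(* The squared Fejér product [|W predT|^2] has mean [M ^ n], while
   [(1 - z_i) W predT] is [1 - z_i ^ M] times the product over the other
   coordinates, of mean square [M ^ n.-1]: for large [M] the mass of
   [|W predT|^2] cannot be carried by points where some [|1 - z_i|] is large. *)
Lemma exists_all_near_one (D : nat) : (4 * D * n < M)%N ->
  exists m, forall i, `|1 - z i m| ^+ 2 *+ D < 1.
Proof.
move=> DM; apply: contrapT => /forallNP far.
(* [Q i] allows only exponent 0 in coordinate [i], so [W (Q i)] lacks the [i]-th factor. *)
pose Q (i j : 'I_n) (a : 'I_M) := (j == i) ==> (a == 0 :> nat).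
have M0 : (0 < M)%N by case: (M) DM.
pose P := (\prod_(j < n) #|xpredT : pred 'I_M|)%N.
have PE : P = (M ^ n)%N by rewrite /P prod_nat_const !card_ord.
have QP i : (M * \prod_j #|Q i j|)%N = P.
  rewrite (bigD1 i)//= /P [RHS](bigD1 i)//= /Q eqxx /=.
  have -> : #|(fun a : 'I_M => true ==> (a == 0 :> nat))| = 1%N.
    by rewrite (@eq_card _ _ (pred1 (Ordinal M0))) ?card1// => a; rewrite !inE.
  rewrite mul1n card_ord; congr (_ * _)%N; apply: eq_bigr => j /negPf ji.
  by rewrite -[RHS]card_ord; apply: eq_card => a; rewrite !inE /Q ji.
have WQ i m : (1 - z i m) * W (fun=> xpredT) m = (1 - z i m ^+ M) * W (Q i) m.
  rewrite /W (bigD1 i)//= [in RHS](bigD1 i)//= !mulrA; congr (_ * _).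
    rewrite /Q eqxx /=; have -> : \sum_(a < M | a == 0 :> nat) z i m ^+ a = 1.
      by rewrite (big_pred1 (Ordinal M0)) ?expr0.
    by rewrite mulr1 -[in RHS]opprB subrX1 -mulNr opprB.
  by apply: eq_bigr => j /negPf ji; apply: eq_bigl => a; rewrite /Q ji.
(* If [|1 - z_i|^2 D >= 1], then [|W|^2 <= D |1 - z_i|^2 |W|^2 = D |1 - z_i^M|^2 |W (Q i)|^2 <= 4 D
   |W (Q i)|^2]. *)
have le_m m : 0 <= \sum_i `|W (Q i) m| ^+ 2 *+ (4 * D) - `|W (fun=> xpredT) m| ^+ 2.
  have /existsNP[i /negP far_i] := far m; rewrite subr_ge0 (bigD1 i)//=.
  have W0 j : 0 <= `|W (Q j) m| ^+ 2 *+ (4 * D) by rewrite mulrn_wge0// exprn_ge0.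
  rewrite -[leLHS]addr0 lerD ?sumr_ge0//.
  have far1 : 1 <= `|1 - z i m| ^+ 2 *+ D.
    by rewrite real_leNgt ?real1// rpredMn// rpredX// normr_real.
  apply: le_trans (ler_peMl _ far1) _; first by rewrite exprn_ge0.
  rewrite mulrnAl -exprMn -normrM WQ normrM exprMn.
  rewrite mulrnA lerMn2r; apply/orP; right.
  rewrite -mulr_natl ler_wpM2r ?exprn_ge0// (_ : 4%:R = 2 ^+ 2) ?ler_pXn2r ?nnegrE//; last first.
    by rewrite -natrX.
  by apply: le_trans (ler_normB _ _) _; rewrite normr1 normrX unit_z expr1n.
have mean : has_mean (fun m => \sum_i `|W (Q i) m| ^+ 2 *+ (4 * D)
     - `|W (fun=> xpredT) m| ^+ 2)
     ((\sum_i (\prod_j #|Q i j|) * (4 * D))%:R - P%:R).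
  apply: has_meanD; last exact/has_meanN/has_mean_norm_trig.
  rewrite natr_sum; apply: has_mean_sum => i _ /=; rewrite natrM mulr_natr.
  by apply: (has_meanMn (f := fun m => `|W (Q i) m| ^+ 2)); apply: has_mean_norm_trig.
(* Comparing means and multiplying by [M] would give [M * P <= 4 * D * n * P], against the choice of
   [M]. *)
have := has_mean_natr_ge0 mean le_m; apply/negP; rewrite -ltnNge.
rewrite -(ltn_pmul2l M0) big_distrr /=.
under eq_bigr do rewrite mulnA QP.
rewrite sum_nat_const card_ord (mulnC P) mulnA ltn_pmul2r 1?mulnC//.
by rewrite PE expn_gt0 M0.
Qed.
End TrigPolynomials.

(** * The circle *)

Definition expi (R : realType) (x : R) : R[i] :=
  Complex (cos (pi *+ 2 * x)) (sin (pi *+ 2 * x)).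

Lemma expiD (R : realType) (x y : R) : expi (x + y) = expi x * expi y.
Proof. by rewrite /expi mulrDr cosD sinD; simpc; rewrite [X in Complex _ X]addrC. Qed.

Lemma expi0 (R : realType) : expi (0 : R) = 1.
Proof. by rewrite /expi mulr0 cos0 sin0. Qed.

Lemma expiN (R : realType) (x : R) : expi (- x) = (expi x)^*.
Proof. by rewrite /expi mulrN cosN sinN. Qed.

Lemma norm_expi (R : realType) (x : R) : `|expi x| = 1.
Proof. by rewrite normc_def /= cos2Dsin2 sqrtr1. Qed.

Lemma expiMn (R : realType) (x : R) n : expi (x *+ n) = expi x ^+ n.
Proof.
by elim: n => [|n IH]; rewrite ?mulr0n ?expi0// mulrS expiD IH exprS.
Qed.

Lemma expi_int (R : realType) (z : int) : expi (z%:~R : R) = 1.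
Proof.
have en n : expi (n%:R : R) = 1.
  by rewrite expiMn /expi mulr1 cos2pi sin2pi expr1n.
by case: z => n; rewrite ?NegzE ?rmorphN /= -?pmulrn ?expiN ?en ?rmorph1.
Qed.

Lemma expi_sum (R : realType) (I : Type) (r : seq I) (F : I -> R) :
  expi (\sum_(i <- r) F i) = \prod_(i <- r) expi (F i).
Proof. by elim/big_rec2: _ => [|i x y _ <-]; rewrite ?expi0 ?expiD. Qed.

Lemma normB1_expi (R : realType) (x : R) :
  `|1 - expi x| ^+ 2 = (2 - 2 * cos (pi *+ 2 * x))%:C%C.
Proof.
rewrite sqr_normc /expi; have := cos2Dsin2 (pi *+ 2 * x).
move: (cos _) (sin _) => c s cs; simpc; congr Complex; last by ring.
by transitivity (1 - 2 * c + (c ^+ 2 + s ^+ 2)); [ring | rewrite cs; ring].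
Qed.

Lemma mul2pi_itv (R : realType) (t : R) :
  0 <= t -> t <= 2^-1 -> 0 <= pi *+ 2 * t <= pi.
Proof.
move=> t0 t2; rewrite mulrnAl -mulrnAr mulr_ge0 ?pi_ge0 ?mulrn_wge0//=.
by rewrite -[leRHS]mulr1 ler_wpM2l ?pi_ge0// mulr2n; lra.
Qed.

Lemma le_cos_2pi (R : realType) (y e : R) : 0 <= e -> e <= `|y| -> `|y| <= 2^-1 ->
  cos (pi *+ 2 * y) <= cos (pi *+ 2 * e).
Proof.
move=> e0 ey y2.
have -> : cos (pi *+ 2 * y) = cos (pi *+ 2 * `|y|).
  by case: (ger0P y) => // _; rewrite mulrN cosN.
have p0 := pi_ge0 R.
rewrite leNgt ltr_cos -?leNgt ?in_itv/=.
- by rewrite ler_wpM2l// mulrn_wge0.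
- by rewrite mul2pi_itv.
- by rewrite mul2pi_itv// (le_trans ey).
Qed.

Lemma exists_nearest_int (R : realType) (x : R) :
  exists z : int, `|x - z%:~R| <= 2^-1.
Proof.
exists (Num.floor (x + 2^-1)); have := floor_itv (x + 2^-1).
by rewrite ler_norml intrD => /andP[]; set f := (_%:~R); lra.
Qed.

Lemma expi_sub_int (R : realType) (x : R) (z : int) : expi (x - z%:~R) = expi x.
Proof. by rewrite expiD -rmorphN /= expi_int mulr1. Qed.

Lemma cos_2pi_lt1 (R : realType) (e : R) : 0 < e -> e <= 2^-1 ->
  cos (pi *+ 2 * e) < 1.
Proof.
move=> e0 e2; have p0 := pi_ge0 R; rewrite -cos0 ltr_cos ?in_itv/= ?lexx//.
- by rewrite mulr_gt0// mulrn_wgt0// pi_gt0.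
- by rewrite mul2pi_itv// ltW.
Qed.

Lemma expi_near_one (R : realType) (e : R) : 0 < e ->
  exists D : nat, forall x : R, `|1 - expi x| ^+ 2 *+ D < 1 ->
    exists z : int, `|x - z%:~R| < e.
Proof.
(* Capping at [1/2] keeps the angles in [[0, pi]], where cosine decreases; then [D] only has to
   exceed the inverse of the least value [q] of [|1 - expi x|^2] at distance at least [e'] from the
   integers. *)
move=> e0; pose e' := Num.min e 2^-1.
have e'0 : 0 < e' by rewrite lt_min e0 invr_gt0 ltr0n.
have e'2 : e' <= 2^-1 by rewrite ge_min lexx orbT.
pose q := 2 - 2 * cos (pi *+ 2 * e').
have q0 : 0 < q by rewrite /q; have := cos_2pi_lt1 e'0 e'2; lra.
exists (Num.bound q^-1) => x xD; have [z zx] := exists_nearest_int x; exists z.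
rewrite ltNge; apply/negP => ex; move: xD.
rewrite -(expi_sub_int x z) normB1_expi -rmorphMn /= (_ : 1 = 1%:C%C)// ltcR.
apply/negP; rewrite -leNgt.
have ec : cos (pi *+ 2 * (x - z%:~R)) <= cos (pi *+ 2 * e').
  by apply: le_cos_2pi => //; [exact: ltW|rewrite ge_min ex].
have : q^-1 < (Num.bound q^-1)%:R by rewrite archi_boundP// invr_ge0 ltW.
move=> /ltW; rewrite -(ler_pM2l q0) divff ?gt_eqF// => /le_trans; apply.
by rewrite mulr_natr lerMn2r; apply/orP; right; rewrite /q lerB// ler_wpM2l.
Qed.

Lemma expi_eq1 (R : realType) (x : R) : expi x = 1 -> exists z : int, x = z%:~R.
Proof.
move=> x1; have [z zx] := exists_nearest_int x; exists z; apply/eqP.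
rewrite -subr_eq0 -normr_le0 leNgt; apply/negP => y0.
have := normB1_expi (x - z%:~R); rewrite expi_sub_int x1 subrr normr0 expr0n /=.
move=> [] /esym; have := le_cos_2pi (ltW y0) (lexx _) zx.
by have := cos_2pi_lt1 y0 zx; lra.
Qed.

Lemma complex_archimedean (R : realType) (x : R[i]) : exists n : nat, `|x| <= n%:R.
Proof.
rewrite normc_def; set r := Num.sqrt _; exists (Num.bound r).
by rewrite -(rmorph_nat (real_complex R)) lecR ltW// archi_boundP// sqrtr_ge0.
Qed.

(** * Characters of the trace-zero matrices *)

Lemma closureT_not_integral (R : realType) (n : nat) (S : set 'rV[R]_n) (c : 'I_n -> int) i :
  closure S = setT -> c i != 0 ->
  exists2 v, S v & expi (\sum_j (c j)%:~R * v 0 j) <> 1.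
Proof.
move=> ST ci0; have ci0' : (c i)%:~R != 0 :> R by rewrite intr_eq0.
(* The linear form takes the value [1/2] at [v0]. The radius [e] below moves it by less than [1/2],
   so near [v0] it stays strictly between 0 and 1. *)
pose v0 : 'rV[R]_n := \row_j (if j == i then (2 * (c i)%:~R)^-1 else 0).
pose l := \sum_j `|(c j)%:~R : R|.
have l0 : 0 <= l by apply: sumr_ge0.
pose e := (2 * (l + 1))^-1.
have e0 : 0 < e by rewrite invr_gt0 mulr_gt0// ltr_wpDl.
have : closure S v0 by rewrite ST.
move=> /(_ (ball v0 e) (nbhsx_ballx _ _ e0)) [v [Sv vb]]; exists v => // /expi_eq1[z zE].
have half : \sum_j (c j)%:~R * v0 0 j = 2^-1.
  rewrite (bigD1 i)//= big1 => [|j /negPf ji]; rewrite !mxE ?ji ?mulr0//.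
  by rewrite eqxx addr0 invfM mulrCA divff// mulr1.
have : `|2^-1 - z%:~R| < 2^-1 :> R.
  rewrite -[X in X - _]half -zE -sumrB; apply: le_lt_trans (ler_norm_sum _ _ _) _.
  apply: (@le_lt_trans _ _ (l * e)).
    rewrite mulr_suml; apply: ler_sum => j _; rewrite -mulrBr normrM ler_wpM2l//.
    by have := vb.2 0 j => /ltW.
  rewrite /e ltr_pdivrMr ?mulr_gt0 ?ltr_wpDl// mulrA mulVf ?pnatr_eq0//.
  by rewrite mul1r ltrDl.
rewrite ltr_norml => /andP[h1 h2].
have : (0 : R) < z%:~R by lra.
have : (z%:~R : R) < 1%:~R by rewrite rmorph1; lra.
by rewrite ltr0z ltr_int; lia.
Qed.

Lemma expi_intvec (n : nat) (v : 'rV[Rdefinitions.R]_n) i : intvec v -> expi (v 0 i) = 1.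
Proof. by move=> [k ->]; rewrite mxE expi_int. Qed.

Definition torus_character (C : numClosedFieldType) (d : nat) (T : 'M[int]_d -> C) :=
  (forall A, `|T A| = 1) /\
  (forall A B, tracefree A -> tracefree B -> T (A + B) = T A * T B).

(** Trace zero is built in because characters are multiplicative only on trace-zero matrices; this
    makes the predicate a pure subgroup of all matrices. *)
Definition has_torsion_image (C : numClosedFieldType) (d : nat) (T : 'M[int]_d -> C) A :=
  tracefree A /\ exists2 N, (0 < N)%N & T A ^+ N = 1.

Lemma tracefreeD (d : nat) (A B : 'M[int]_d) :
  tracefree A -> tracefree B -> tracefree (A + B).
Proof. by rewrite /tracefree linearD /= => -> ->; rewrite addr0. Qed.

Lemma tracefreeB (d : nat) (A B : 'M[int]_d) :
  tracefree A -> tracefree B -> tracefree (A - B).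
Proof. by rewrite /tracefree linearB /= => -> ->; rewrite subrr. Qed.

Lemma tracefreeMn (d : nat) (A : 'M[int]_d) n : tracefree A -> tracefree (A *+ n).
Proof. by rewrite /tracefree linearMn /= => ->; rewrite mul0rn. Qed.

Section TorusCharacter.
Context (C : numClosedFieldType) (d : nat) (T : 'M[int]_d -> C).
Context (Tchar : torus_character T).

Lemma character_neq0 A : T A != 0.
Proof. by rewrite -normr_eq0 (Tchar.1) oner_eq0. Qed.

Lemma character0 : T 0 = 1.
Proof.
have tf0 : tracefree (0 : 'M[int]_d) by rewrite /tracefree linear0.
apply: (mulfI (character_neq0 0)); rewrite mulr1.
by have [_ <-] := Tchar; rewrite ?addr0.
Qed.

Lemma characterMn A n : tracefree A -> T (A *+ n) = T A ^+ n.
Proof.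
move=> A0; elim: n => [|n IHn]; first by rewrite mulr0n character0.
by rewrite mulrS (Tchar.2) ?IHn ?exprS//; apply: tracefreeMn.
Qed.

Lemma characterB A B : tracefree A -> tracefree B -> T (A - B) = T A / T B.
Proof.
move=> A0 B0; apply: (mulIf (character_neq0 B)); rewrite divfK ?character_neq0//.
by rewrite -(Tchar.2) ?subrK//; apply: tracefreeB.
Qed.

Lemma pure_has_torsion_image : pure_subgroup (has_torsion_image T).
Proof.
split=> [|A B [A0 [N N0 AN]] [B0 [M M0 BM]]|A n n0 [An0 [N N0 AN]]].
- by split; [rewrite /tracefree linear0 | exists 1%N; rewrite // character0 expr1n].
- split; first exact: tracefreeB.
  exists (N * M)%N; first by rewrite muln_gt0 N0.
  by rewrite characterB// exprMn exprM AN exprVn mulnC exprM BM !expr1n invr1 mulr1.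
have A0 : tracefree A.
  by apply/eqP; move/eqP: An0; rewrite linearMn mulrn_eq0 eqn0Ngt n0.
split=> //; exists (n * N)%N; first by rewrite muln_gt0 n0.
by rewrite exprM -characterMn.
Qed.
End TorusCharacter.

(** The trace-zero matrices are finitely generated, so the product of torsion exponents of the
    generators works for all of them. *)
Lemma character_common_torsion (C : numClosedFieldType) (d : nat) (T : 'M[int]_d.+1 -> C) :
  torus_character T -> (forall A, tracefree A -> has_torsion_image T A) ->
  exists2 N, (0 < N)%N & forall A, tracefree A -> T A ^+ N = 1.
Proof.
move=> Tchar Ttors.
pose G (p : 'I_d.+1 * 'I_d.+1) : 'M[int]_d.+1 :=
  if p.1 == p.2 then delta_mx p.1 p.1 - delta_mx ord0 ord0 else delta_mx p.1 p.2.
have tr_delta (i j : 'I_d.+1) : \tr (delta_mx i j : 'M[int]_d.+1) = (i == j)%:R.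
  rewrite /mxtrace (bigD1 i)//= !mxE eqxx big1 ?addr0// => k /negPf ki.
  by rewrite mxE ki.
have G0 p : tracefree (G p).
  rewrite /tracefree /G; case: eqVneq => [_|/negPf ij]; last by rewrite tr_delta ij.
  by rewrite linearB /= !tr_delta !eqxx subrr.
have /choice[N NP] : forall p, exists N, (0 < N)%N /\ T (G p) ^+ N = 1.
  by move=> p; have [_ [N N0 NE]] := Ttors _ (G0 p); exists N.
have Gtors p : T (G p) ^+ (\prod_q N q) = 1.
  by rewrite (bigD1 p)//= exprM (NP p).2 expr1n.
exists (\prod_q N q)%N; first by rewrite prodn_gt0// => p; case: (NP p).
move=> A A0; suff [] : tracefree A /\ T A ^+ (\prod_q N q) = 1 by [].
move: A A0; apply: tracefree_ind.
- by split; [rewrite /tracefree linear0 | rewrite character0 ?expr1n].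
- move=> A B [A0 AN] [B0 BN]; split; first exact: tracefreeB.
  by rewrite characterB// exprMn AN exprVn BN invr1 mulr1.
- move=> i j ij; have := Gtors (i, j); have := G0 (i, j).
  by rewrite /G /= (negPf ij).
- by move=> i; have := Gtors (i, i); have := G0 (i, i); rewrite /G /= eqxx.
Qed.

Section TorusHom.
Context (d n : nat) (tau : 'M[int]_d -> 'rV[Rdefinitions.R]_n).
Context (hom : torus_hom tau).

Definition coord_character i A := expi (tau A 0 i).

Lemma coord_characterP i : torus_character (coord_character i).
Proof.
split=> [A|A B A0 B0]; first exact: norm_expi.
have := expi_intvec i (hom A0 B0); rewrite /coord_character -expiD !mxE => e1.
have -> : tau (A + B) 0 i = (tau (A + B) 0 i - tau A 0 i - tau B 0 i)
  + (tau A 0 i + tau B 0 i) by ring.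
by rewrite [LHS]expiD e1 mul1r.
Qed.

Definition monomial M (f : {ffun 'I_n -> 'I_M}) A :=
  \prod_i coord_character i A ^+ f i.

(** These are the cross terms in the expanded square of a Fejér product: torus characters with
    integer frequency [p.1 - p.2], pulled back along [tau]. *)
Definition monomial_ratio M (p : {ffun 'I_n -> 'I_M} * {ffun 'I_n -> 'I_M}) A :=
  monomial p.1 A * (monomial p.2 A)^*.

Lemma monomial_ratioE M (p : {ffun 'I_n -> 'I_M} * {ffun 'I_n -> 'I_M}) A :
  monomial_ratio p A
  = expi (\sum_i ((p.1 i)%:Z - (p.2 i)%:Z)%:~R * tau A 0 i).
Proof.
have mE (f : {ffun 'I_n -> 'I_M}) : monomial f A = expi (\sum_i tau A 0 i *+ f i).
  by rewrite expi_sum; apply: eq_bigr => i _; rewrite expiMn.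
rewrite /monomial_ratio !mE -expiN -expiD -sumrN -big_split /=.
congr expi; apply: eq_bigr => i _.
by rewrite rmorphB /= mulrBl -!pmulrn !mulr_natl.
Qed.

Lemma monomial_ratioP M p : torus_character (@monomial_ratio M p).
Proof.
split=> [A|A B A0 B0]; first by rewrite monomial_ratioE norm_expi.
have mM (f : {ffun 'I_n -> 'I_M}) : monomial f (A + B) = monomial f A * monomial f B.
  rewrite /monomial -big_split /=; apply: eq_bigr => i _.
  by rewrite (coord_characterP i).2// exprMn.
by rewrite /monomial_ratio !mM rmorphM; ring.
Qed.
End TorusHom.

(** If every value were torsion, a common exponent [N] would make the nonzero frequency
    [N (p.1 - p.2)] trivial on the image of [tau], contradicting density. *)
Lemma monomial_ratio_proper d n (tau : 'M[int]_d.+1 -> 'rV[Rdefinitions.R]_n) M p :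
  torus_hom tau -> torus_dense tau -> p.1 != p.2 ->
  exists2 A, tracefree A & ~ has_torsion_image (@monomial_ratio d.+1 n tau M p) A.
Proof.
move=> hom dense p12; apply: contrapT => allT.
have [|N N0 NP] := character_common_torsion (monomial_ratioP hom p).
  by move=> A A0; apply: contrapT => nA; apply: allT; exists A.
pose c i := ((p.1 i)%:Z - (p.2 i)%:Z) *+ N.
have [i ci] : exists i, c i != 0.
  apply: contrapT => /forallNP c0; case/negP: p12; apply/eqP/ffunP => i.
  have /negP := c0 i; rewrite negbK /c mulrn_eq0 eqn0Ngt N0 /= subr_eq0 => /eqP[].
  exact: val_inj.
have [_ [A [k [A0 [k0 ->]]]] []] := closureT_not_integral dense ci.
have -> : \sum_j (c j)%:~R * (tau A + k) 0 j
   = (\sum_i ((p.1 i)%:Z - (p.2 i)%:Z)%:~R * tau A 0 i) *+ N + \sum_j (c j)%:~R * k 0 j.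
  rewrite -sumrMnl -big_split; apply: eq_bigr => j _ /=.
  by rewrite mxE mulrDr /c rmorphMn mulrnAl.
rewrite expiD expiMn -monomial_ratioE NP// mul1r expi_sum big1// => j _.
have [k' ->] := k0; rewrite mxE -intrM; exact: expi_int.
Qed.

(** * Return of a quadratic sequence of conjugates to the Bohr set *)

Theorem mainTheorem1 (d : nat) (B : set 'M[int]_d) :
  (2 <= d)%N -> bohr_zero_nonperiodic B ->
  forall C : 'M[int]_d, tracefree C ->
    exists (A : 'M[int]_d) (g : 'M[int]_d),
      B A /\ SLZ g /\ C = invmx g *m A *m g.
Proof.
case: d B => // d B _ [n [tau [U [_ hom dense [Uopen Uper] [U0 ->]]]]] C C0.
(* For [C = 0] the trace kernel is not proper, so [A = 0] is taken directly; the lift [tau 0] is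
   only known to be an integer vector, which periodicity of [U] absorbs. *)
have [-> | /eqP nC0] := eqVneq C 0.
  have tf0 : tracefree (0 : 'M[int]_d.+1) by rewrite /tracefree linear0.
  exists 0, 1%:M; split; last by split; rewrite /SLZ ?det1// mulmx0 mul0mx.
  split=> //; have := hom _ _ tf0 tf0; rewrite addr0 subrr sub0r => -[k kE].
  rewrite -[tau 0]add0r; apply: Uper => //; exists (- k).
  by rewrite -[LHS]opprK kE; apply/rowP => i; rewrite !mxE rmorphN.
have /nbhs_ballP[e e0 eU] : nbhs (0 : 'rV[Rdefinitions.R]_n) U by exact: open_nbhs_nbhs.
have [D DP] := expi_near_one e0.
pose M := (4 * D * n).+1.
(* One subgroup to avoid for each pair of distinct exponent vectors; [None] stands for the trace
   kernel of [C], whose avoidance makes the leading coefficient [c] nonzero. *)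
pose I := option {p : {ffun 'I_n -> 'I_M} * {ffun 'I_n -> 'I_M} | p.1 != p.2}.
pose Z (o : I) A := if o is Some p then has_torsion_image (monomial_ratio tau (val p)) A
  else \tr (C *m A) = 0.
have Zpure o : pure_subgroup (Z o).
  case: o => [p|]; last exact: pure_trace_kernel.
  exact/pure_has_torsion_image/monomial_ratioP.
have [|p pZ] := skew_nilpotent_avoid Zpure.
  case=> [[p p12]|]; last exact: trace_kernel_proper.
  exact: monomial_ratio_proper.
set N := skew_nilpotent p in pZ; pose c := -4 * \tr (C *m N).
pose X := 2 *: (N *m C - C *m N).
have N0 : tracefree N by apply: skew_nilpotent_tracefree.
have Y0 : tracefree (c *: N) by rewrite /tracefree linearZ /= N0 mulr0.
have X0 : tracefree X.
  by rewrite /tracefree linearZ linearB /= mxtrace_mulC subrr mulr0.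
have nc0 : c != 0 by rewrite mulf_neq0//; apply/eqP/(pZ None).
have charE (T : 'M[int]_d.+1 -> Rdefinitions.R[i]) m : torus_character T ->
    T (C + X *+ m + (c *: N) *+ m ^ 2) = T C * T X ^+ m * T (c *: N) ^+ (m ^ 2).
  move=> Tc; have [Xm Ym] := (tracefreeMn m X0, tracefreeMn (m ^ 2) Y0).
  by rewrite !Tc.2//; [rewrite !characterMn | exact: tracefreeD].
pose z i m := coord_character tau i (C + X *+ m + (c *: N) *+ m ^ 2).
have orth (f g : {ffun 'I_n -> 'I_M}) : f != g ->
    has_mean (fun m => \prod_i z i m ^+ f i * (\prod_i z i m ^+ g i)^*) 0.
  move=> fg; pose T := monomial_ratio tau (f, g).
  have Tc : torus_character T by apply: monomial_ratioP.
  apply: (@eq_has_mean _ (fun m => T C * T X ^+ m * T (c *: N) ^+ (m ^ 2))).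
    by move=> m; rewrite -charE.
  apply: has_mean_quadratic_phase; rewrite ?Tc.1//; first exact: complex_archimedean.
  (* A torsion value at [c *: N] would by purity force one at [N], which was chosen to avoid it. *)
  move=> k k0; apply/eqP => Tk; apply: (pZ (Some (exist _ (f, g) fg))).
  by apply: (pureZ (Zpure _) nc0); split=> //; exists k.
have [m mP] := exists_all_near_one orth (fun i m => norm_expi _) (leqnn _).
have [g [g1 gC]] := conj_skew_nilpotent C p m.
exists (C + X *+ m + (c *: N) *+ m ^ 2), g; split=> //; split.
  by do 2?[apply: tracefreeD] => //; apply: tracefreeMn.
have /choice[k kP] : forall i, exists k : int,
    `|tau (C + X *+ m + (c *: N) *+ m ^ 2) 0 i - k%:~R| < e.
  by move=> i; apply: DP; apply: mP.
(* [w] is the integer vector near [v]: the difference lies in the ball inside [U], and periodicity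
   brings back [v]. *)
set v := tau _ in kP *; pose w : 'rV[Rdefinitions.R]_n := \row_i (k i)%:~R.
rewrite -(subrK w v); apply: Uper.
  by exists (\row_i k i); apply/rowP => i; rewrite !mxE.
apply: eU; split=> // i j; rewrite ord1 /ball /= !mxE sub0r normrN; exact: kP.
Qed.
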